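(* Let $\mathbb{K}$ be a field of characteristic zero, let $(A,R)$ be an associative (not necessarily commutative) Rota--Baxter algebra of weight $\theta\in\mathbb{K}$ and let $x_1,\ldots,x_n\in A$. Then $$\sum_{\sigma\in S_n}R\Bigl(R\bigl(\cdots R(x_{\sigma_1})x_{\sigma_2}\cdots\bigr)x_{\sigma_n}\Bigr)=\sum_{\pi\in\mathcal{OP}_n}\omega(\pi)\,\mathtt{L}_\theta(\pi_1)\cdot\ \cdots\ \cdot\mathtt{L}_\theta(\pi_k),$$ where the right-hand sum runs over all ordered set partitions $\pi=(\pi_1,\dots,\pi_k)$ of $\{1,\dots,n\}$.
   Context: A Rota--Baxter algebra of weight $\theta$ is an associative $\mathbb{K}$-algebra $A$ with a linear map $R:A\to A$ such that $R(x)R(y)=R\bigl(R(x)y+xR(y)+\theta xy\bigr)$ for all $x,y$. $\mathcal{OP}_n$ is the set of ordered partitions of $[n]=\{1,\dots,n\}$, i.e. sequences $\pi=(\pi_1,\dots,\pi_k)$ (any $k\ge1$) of disjoint nonempty subsets (blocks) whose union is $[n]$. With $m_i:=|\pi_i|$, set $$\omega(\pi):=\bigl(m_1(m_1+m_2)\cdots(m_1+\cdots+m_k)\bigr)^{-1}.$$ The left pre-Lie product is $a\triangleright_\theta b:=R(a)b-bR(a)-\theta ba$, and $$\mathfrak{l}_\theta^{(m)}(a_1,\dots,a_m):=\bigl(\cdots((a_1\triangleright_\theta a_2)\triangleright_\theta a_3)\cdots\triangleright_\theta a_{m-1}\bigr)\triangleright_\theta a_m,\qquad \mathfrak{l}_\theta^{(1)}(a):=a.$$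 For a block $\pi_i=\{j_1,\dots,j_{m_i}\}$, $$\mathtt{L}_\theta(\pi_i):=\sum_{\sigma\in S_{m_i}}R\bigl(\mathfrak{l}_\theta^{(m_i)}(x_{j_{\sigma_1}},\dots,x_{j_{\sigma_{m_i}}})\bigr).$$ *)

(* Defs.v *)
From HB Require Import structures.
From mathcomp Require Import all_boot all_order all_algebra all_fingroup.

Set Implicit Arguments.
Unset Strict Implicit.
Unset Printing Implicit Defensive.

Import GRing.Theory.
Local Open Scope ring_scope.

(* (... ((a_1 op a_2) op a_3) ...) op a_m.  The value 0 at the empty sequence
   is a dummy: there may be no neutral element. *)
Definition lfold (V : nmodType) (op : V -> V -> V) (s : seq V) : V :=
  if s is a :: s' then foldl op a s' else 0.

(* Ordered set partitions of {0, ..., n-1}, as sequences of blocks. *)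
Definition ordered_partition (n : nat) (p : seq {set 'I_n}) : bool :=
  [&& (0 < size p)%N, all (fun B : {set 'I_n} => B != set0) p,
      pairwise (fun B C : {set 'I_n} => [disjoint B & C]) p &
      \bigcup_(B <- p) B == [set: 'I_n]].

(* Hence the finite type n.-bseq {set 'I_n} of sequences of length at most n
   contains all the ordered partitions. *)
Lemma ordered_partition_size (n : nat) (p : seq {set 'I_n}) :
  ordered_partition p -> (size p <= n)%N.
Proof.
case/and4P=> _ ne dis _.
suff le_card : (size p <= #|\bigcup_(B <- p) B|)%N.
  by rewrite (leq_trans le_card) // -[leqRHS]card_ord max_card.
elim: p ne dis => [|B p IHp] //= /andP[B0 ne] /andP[disB dis].
rewrite big_cons cardsU disjoint_setI0 ?cards0 ?subn0.
  by rewrite -add1n leq_add ?IHp // card_gt0.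
elim: p disB {IHp ne dis} => [|C p IHp] /=.
  by rewrite big_nil disjoints_subset setC0 subsetT.
case/andP=> disC disB; rewrite big_cons -setI_eq0 setIUr setU_eq0 !setI_eq0.
by rewrite disC IHp.
Qed.

Definition omega (K : fieldType) (n : nat) (p : seq {set 'I_n}) : K :=
  (\prod_(i < size p) (\sum_(B <- take i.+1 p) #|B|)%N%:R)^-1.

Section RotaBaxter.

(* The algebras are not assumed to be unital, so the product is a bilinear map
   and not the multiplication of an algType, which has a neutral element. *)
Variables (K : fieldType) (A : lmodType K).
Variables (mul : {bilinear A -> A -> A}) (R : {linear A -> A}) (theta : K).

Definition rota_baxter : Prop :=
  associative mul /\
  forall x y : A,
    mul (R x) (R y) = R (mul (R x) y + mul x (R y) + theta *: mul x y).

Definition prelie (a b : A) : A :=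
  mul (R a) b - mul b (R a) - theta *: mul b a.

(* R (R (... R (R a_1 * a_2) ...) * a_m) *)
Definition nestedR (s : seq A) : A := R (lfold (fun a b => mul (R a) b) s).

(* enum_val : 'I_#|B| -> 'I_n enumerates the elements of the block B. *)
Definition Lblock (n : nat) (x : 'I_n -> A) (B : {set 'I_n}) : A :=
  \sum_(s : 'S_#|B|) R (lfold prelie [seq x (enum_val (s i)) | i : 'I_#|B|]).

End RotaBaxter.

(* Main.v *)
(* For a set S of indices let F(S) be the sum of R(...R(R(x_i1) x_i2)... x_im)
   over the orderings of S, with F(empty) = 1, and l(S) that of the left
   pre-Lie words.  Then, as for a noncommutative logarithmic derivative,
     |S| F(S) = sum over nonempty B included in S of F(S \ B) R(l(B)).
   By induction on |S|: the Rota-Baxter identity moves R outside each summand,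
   the definition of the pre-Lie product then makes the terms telescope, and
   what remains is R of the sum over i in S of (1 + |S \ i|) F(S \ i) x_i.
   Since the last factor of omega(pi)^-1 is |S|, removing the last block shows
   that the right-hand side of the theorem obeys the same recursion. *)
Require Import Defs.
From mathcomp Require Import all_boot all_order all_algebra all_fingroup.

Set Implicit Arguments.
Unset Strict Implicit.
Unset Printing Implicit Defensive.

Import GRing.Theory.
Local Open Scope ring_scope.

(** * Orderings of a finite set as words *)

Lemma perm_enum_set (T : finType) (S : {set T}) (w : seq T) :
  perm_eq w (enum S) = uniq w && ([set:: w] == S).
Proof.
apply/idP/andP=> [eq_w | [uniq_w /eqP <-]].
  rewrite (perm_uniq eq_w) enum_uniq; split=> //.
  by apply/eqP/setP=> i; rewrite inE (perm_mem eq_w) mem_enum.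
by apply: uniq_perm; rewrite ?enum_uniq // => i; rewrite mem_enum inE.
Qed.

(** Sorting orderings by their last letter underlies the recursion for word sums. The empty set is
    excluded: its one ordering has no last letter. *)
Lemma perm_permutations_rcons (T : finType) (S : {set T}) : S != set0 ->
  perm_eq (permutations (enum S))
    [seq rcons w i | i <- enum S, w <- permutations (enum (S :\ i))].
Proof.
move=> S0; apply: uniq_perm; first exact: permutations_uniq.
  apply: allpairs_uniq_dep => [|i _|]; first exact: enum_uniq.
    exact: permutations_uniq.
  by move=> [i w] [j v] _ _ /= /rcons_inj[-> ->].
move=> w; rewrite mem_permutations perm_enum_set; apply/andP/allpairsPdep.
  case/lastP: w => [|w i] [].
    by move=> _ /eqP eqS; case/set0Pn: S0 => i; rewrite -eqS !inE.
  rewrite rcons_uniq => /andP[iw uw] /eqP <-.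
  exists i, w; split=> //; first by rewrite mem_enum inE mem_rcons mem_head.
  rewrite mem_permutations perm_enum_set uw; apply/eqP/setP=> j.
  by rewrite !inE mem_rcons inE; case: eqVneq => [->|] //=; apply/negbTE.
case=> i [v [iS]]; rewrite mem_permutations perm_enum_set mem_enum in iS *.
case/andP=> uv /eqP eqv ->; split.
  rewrite rcons_uniq uv andbT; move/setP/(_ i): eqv.
  by rewrite !inE eqxx => ->.
apply/eqP/setP=> j; rewrite inE mem_rcons inE; move/setP/(_ j): eqv.
by rewrite !inE => ->; case: eqVneq => [->|].
Qed.

(** Injectivity of [h] makes distinct permutations give distinct words, so a sum over the symmetric
    group becomes one over orderings. *)
Lemma sum_perm_words (T : eqType) (V : nmodType) (m : nat) (h : 'I_m -> T)
    (f : seq T -> V) : injective h ->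
  \sum_(s : 'S_m) f [seq h (s i) | i : 'I_m] =
  \sum_(w <- permutations (codom h)) f w.
Proof.
move=> inj_h; pose word (s : 'S_m) := [seq h (s i) | i : 'I_m].
transitivity (\sum_(w <- [seq word s | s : 'S_m]) f w);
  first by rewrite big_image.
apply: perm_big; apply: uniq_perm; last 1 first.
- move=> w; rewrite mem_permutations -[codom h]/(val [tuple h i | i < m]).
  apply/imageP/tuple_permP => [[s _ ->] | [s ->]]; exists s => //;
    by apply: eq_map => i; rewrite tnth_mktuple.
- rewrite map_inj_in_uniq ?enum_uniq // => s t _ _ eq_st; apply/permP=> i.
  apply: inj_h; by move/eq_in_map: eq_st; apply; rewrite mem_enum.
exact: permutations_uniq.
Qed.

(** * Sums over the orderings of a set *)

Section WordSums.

Variables (T : finType) (V : zmodType) (op : V -> V -> V) (x : T -> V).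
Hypothesis opD : forall b, {morph op^~ b : u v / u + v}.

Definition word_sum (S : {set T}) : V :=
  \sum_(w <- permutations (enum S)) lfold op (map x w).

Lemma lfold_rcons (s : seq V) (a : V) :
  lfold op (rcons s a) = if s is [::] then a else op (lfold op s) a.
Proof. by case: s => //= b s; rewrite foldl_rcons. Qed.

Lemma word_sum0 : word_sum set0 = 0.
Proof. by rewrite /word_sum enum_set0 big_cons big_nil addr0. Qed.

Lemma word_sum_rec (S : {set T}) :
  word_sum S = \sum_(i in S)
    if S :\ i == set0 then x i else op (word_sum (S :\ i)) (x i).
Proof.
have [->|S0] := eqVneq S set0; first by rewrite word_sum0 big_set0.
rewrite /word_sum (perm_big _ (perm_permutations_rcons S0)) big_allpairs_dep.
rewrite big_enum; apply: eq_bigr => i iS.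
under eq_bigr do rewrite map_rcons lfold_rcons.
case: eqVneq => [->|Si0]; first by rewrite enum_set0 big_seq1.
have op0 b : op 0 b = 0.
  by apply: (addIr (op 0 b)); rewrite -[LHS](opD b) addr0 add0r.
rewrite (big_morph (op^~ (x i)) (opD (x i)) (op0 (x i))).
(* Here [S :\ i] is nonempty, so its orderings are too and [lfold] never takes its dummy value. *)
apply: eq_big_seq => w; rewrite mem_permutations => /perm_size.
by rewrite -cardE; case: w => //= /esym/eqP; rewrite cards_eq0 (negPf Si0).
Qed.

End WordSums.

(** * The Dynkin identity in a Rota-Baxter algebra *)

Section DynkinIdentity.

Variables (T : finType) (K : fieldType) (A : lmodType K).
Variables (mul : {bilinear A -> A -> A}) (R : {linear A -> A}) (theta : K).
Hypothesis RB : rota_baxter mul R theta.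
Variable x : T -> A.

Local Notation N := (word_sum (fun a b => mul (R a) b) x).
Local Notation L := (word_sum (prelie mul R theta) x).

(* Left multiplication by [R (N S)], which is replaced by a unit if [S] is
   empty, as [A] may have none. *)
Definition lact (S : {set T}) (y : A) : A :=
  if S == set0 then y else mul (R (N S)) y.

Lemma lactD S : {morph lact S : y z / y + z}.
Proof. by move=> y z; rewrite /lact; case: ifP => // _; rewrite linearD. Qed.

Lemma lactB S : {morph lact S : y z / y - z}.
Proof. by move=> y z; rewrite /lact; case: ifP => // _; rewrite linearB. Qed.

Lemma lactZ S c : {morph lact S : y / c *: y}.
Proof. by move=> y; rewrite /lact; case: ifP => // _; rewrite linearZ. Qed.

Lemma lact_sum S (I : Type) (r : seq I) (P : pred I) (F : I -> A) :
  lact S (\sum_(i <- r | P i) F i) = \sum_(i <- r | P i) lact S (F i).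
Proof.
by rewrite /lact; case: ifP => // _; rewrite linear_sum.
Qed.

Lemma mul_lact S y z : mul (lact S y) z = lact S (mul y z).
Proof. by rewrite /lact; case: ifP => // _; rewrite RB.1. Qed.

Lemma prelieDl b : {morph (prelie mul R theta)^~ b : u v / u + v}.
Proof.
move=> u v; rewrite /prelie !linearD linearDl.
by rewrite [X in X + _ = _]addrACA [LHS]addrACA.
Qed.

Lemma nested_rec S : N S = \sum_(i in S) lact (S :\ i) (x i).
Proof.
by rewrite word_sum_rec // => b u v; rewrite linearD linearDl.
Qed.

(** The Rota-Baxter identity puts all terms under one [R]. Expand [N S] by its last letter and use
    that x_i R(b) + theta x_i b is R(b) x_i minus the pre-Lie product of b and x_i. *)
Lemma lact_rota_baxter S b :
  lact S (R b) = R (lact S b + \sum_(i in S)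
    (lact (S :\ i) (mul (R b) (x i)) -
     lact (S :\ i) (prelie mul R theta b (x i)))).
Proof.
rewrite {1 2}/lact; case: eqVneq => [->|S0]; first by rewrite big_set0 addr0.
rewrite RB.2 -addrA; congr (R (_ + _)).
rewrite nested_rec !linear_sumlz scaler_sumr -big_split.
apply: eq_bigr => i _ /=.
rewrite !mul_lact -lactZ -lactD -lactB; congr (lact _ _).
by rewrite /prelie !opprB [RHS]addrCA [_ + (_ - _)]addrC subrK addrC.
Qed.

(** Pairs of a set [B] and a member [i] correspond to pairs of [i] and [C], where [B] is
    [i |: C]. *)
Lemma exchange_big_setU1 (S : {set T}) (F : T -> {set T} -> A) :
  \sum_(B : {set T} | B \subset S) \sum_(i in B) F i (B :\ i) =
  \sum_(i in S) \sum_(C : {set T} | C \subset S :\ i) F i C.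
Proof.
rewrite (exchange_big_dep (mem S)) /= => [|B i /subsetP sBS /sBS //].
apply: eq_bigr => i iS.
rewrite (reindex_onto (fun C => i |: C) (fun B => B :\ i)) /= => [|B /andP[_]].
  apply: eq_big => [C|C /andP[_ /eqP -> //]].
  rewrite setU11 andbT subUset sub1set iS /= subsetD1; congr (_ && _).
  apply/eqP/idP => [<-|iC]; first by rewrite !inE eqxx.
  by rewrite setU1K.
exact: setD1K.
Qed.

(* Rewriting [lact (S :\: B) (R (L B))] by the Rota-Baxter identity creates
   terms with [L B] and with [prelie (L B) (x i)]; by the recursion for [L], the
   latter cancel all the former but those where [B] is a singleton. *)
Lemma dynkin_identity (S : {set T}) :
  \sum_(B : {set T} | (B \subset S) && (B != set0)) lact (S :\: B) (R (L B)) =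
  #|S|%:R *: R (N S).
Proof.
move: {2}#|S| (leqnn #|S|) => n; elim: n S => [|n IHn] S leSn.
  move: leSn; rewrite leqn0 cards_eq0 => /eqP ->.
  rewrite cards0 scale0r big1 // => B /andP[].
  by rewrite subset0 => ->.
under eq_bigr do rewrite lact_rota_baxter.
rewrite -linear_sum -linearZ /=; congr (R _); rewrite big_split /=.
have -> : \sum_(B : {set T} | (B \subset S) && (B != set0))
      lact (S :\: B) (L B) =
    \sum_(i in S) (lact (S :\ i) (x i) +
      \sum_(C : {set T} | (C \subset S :\ i) && (C != set0))
         lact (S :\ i :\: C) (prelie mul R theta (L C) (x i))).
  (* [F i C] is the share of the block [i |: C] whose words end in [i]; an empty [C] gives the
     singletons. *)
  pose F i C := lact (S :\ i :\: C)
    (if C == set0 then x i else prelie mul R theta (L C) (x i)).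
  transitivity (\sum_(B : {set T} | B \subset S) \sum_(i in B) F i (B :\ i)).
    rewrite big_mkcondr; apply: eq_bigr => B _.
    case: eqVneq => [->|B0]; first by rewrite big_set0.
    rewrite word_sum_rec; last exact: prelieDl.
    rewrite lact_sum; apply: eq_bigr => i iB; rewrite /F; congr (lact _ _).
    by rewrite setDDl setD1K.
  rewrite exchange_big_setU1; apply: eq_bigr => i iS.
  rewrite (bigD1 set0) ?sub0set //= {1}/F eqxx setD0; congr (_ + _).
  by apply: eq_bigr => C /andP[_ C0]; rewrite /F (negPf C0).
rewrite (exchange_big_dep (mem S)) /= => [|B i _]; last
  by rewrite inE => /andP[].
rewrite -big_split nested_rec scaler_sumr; apply: eq_bigr => i iS /=.
have subS (C : {set T}) : [&& C \subset S, C != set0 & i \in S :\: C] =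
    (C \subset S :\ i) && (C != set0).
  by rewrite subsetD1 inE iS andbT -!andbA; congr (_ && _); rewrite andbC.
under [X in _ + X]eq_bigl do rewrite -andbA subS.
rewrite -addrA -big_split /=.
(* The pre-Lie terms cancel. What is left is a summand of the identity for [S :\ i], multiplied by
   [x i]. *)
under [X in _ + X]eq_bigr => C _.
  rewrite (setDDl _ C) (setUC C) -setDDl addrC subrK -mul_lact.
  over.
rewrite -linear_sumlz IHn; last
  by rewrite -ltnS (leq_trans _ leSn) // (cardsD1 i S) iS.
have -> : #|S| = #|S :\ i|.+1 by rewrite (cardsD1 i S) iS.
rewrite linearZl_LR /= -natr1 scalerDl scale1r addrC; congr (_ + _).
(* For empty [S :\ i], [lact] acts as a unit although [N set0] is 0, but its coefficient here is
   0. *)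
rewrite /lact; case: eqVneq => // ->; by rewrite cards0 !scale0r.
Qed.

End DynkinIdentity.

(** * Sequences of blocks and their last block *)

Section OrderedPartitions.

Variable T : finType.
Implicit Types (S B : {set T}) (p q : seq {set T}).

(** The set [S] is arbitrary and the empty sequence is allowed for empty [S], so that removing last
    blocks reaches a base case. *)
Definition block_seq S p : bool :=
  [&& all (fun C : {set T} => C != set0) p,
      pairwise (fun B C : {set T} => [disjoint B & C]) p &
      \bigcup_(B <- p) B == S].

Lemma block_seq_nil S : block_seq S [::] = (S == set0).
Proof. by rewrite /block_seq /= big_nil eq_sym. Qed.

Lemma all_disjoint_bigcup q B :
  all (fun C : {set T} => [disjoint C & B]) q =
  [disjoint \bigcup_(C <- q) C & B].
Proof.
elim: q => [|C q IHq]; first by rewrite big_nil -setI_eq0 set0I eqxx.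
by rewrite big_cons /= IHq -!setI_eq0 setIUl setU_eq0.
Qed.

(** A set [U] is disjoint from [B] with union [S] exactly if [B] lies in [S] and [U] is
    [S :\: B]. *)
Lemma block_seq_rcons S q B :
  block_seq S (rcons q B) = [&& B \subset S, B != set0 & block_seq (S :\: B) q].
Proof.
rewrite /block_seq all_rcons pairwise_rcons big_rcons /= all_disjoint_bigcup.
have -> : [&& B \subset S, B != set0,
            all (fun C : {set T} => C != set0) q,
            pairwise (fun B C : {set T} => [disjoint B & C]) q
            & \bigcup_(C <- q) C == S :\: B] =
    [&& (B != set0) && all (fun C : {set T} => C != set0) q,
        pairwise (fun B C : {set T} => [disjoint B & C]) q
      & (B \subset S) && (\bigcup_(C <- q) C == S :\: B)].
  by do !case: (_ != set0) (all _ _) (pairwise _ _) (B \subset S)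
    => [] [] [] [].
rewrite -!andbA; do 2 congr (_ && _); rewrite andbCA; congr (_ && _).
set U := \bigcup_(C <- q) C; apply/andP/andP=> [[UB /eqP <-] | [BS /eqP ->]].
  rewrite subsetUr setDUl setDv setU0; split=> //; rewrite eq_sym.
  by apply/eqP/setDidPl.
rewrite -setI_eq0 setDE -setIA [_ :&: B]setIC setICr setI0; split=> //.
by rewrite setUC setUIr setUCr setIT; apply/eqP/setUidPr.
Qed.

Lemma block_seq_card S p : block_seq S p -> (\sum_(B <- p) #|B|)%N = #|S|.
Proof.
elim/last_ind: p S => [|p B IHp] S.
  by rewrite block_seq_nil big_nil => /eqP ->; rewrite cards0.
rewrite block_seq_rcons big_rcons => /and3P[BS _ /IHp -> /=].
by rewrite addnC -(cardsID B S) (setIidPr BS).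
Qed.

(* All the block sequences of [S], provided that [#|S| <= k]. *)
Fixpoint block_seqs (k : nat) (S : {set T}) : seq (seq {set T}) :=
  if S == set0 then [:: [::]] else
  if k is k'.+1 then
    [seq rcons q B |
       B <- enum [pred B : {set T} | (B \subset S) && (B != set0)],
       q <- block_seqs k' (S :\: B)]
  else [::].

Lemma card_setD_block k S B : B \subset S -> B != set0 ->
  (#|S| <= k.+1)%N -> (#|S :\: B| <= k)%N.
Proof.
move=> BS; rewrite -card_gt0 => B_gt0 leSk; rewrite -ltnS (leq_trans _ leSk) //.
by rewrite -(cardsID B S) (setIidPr BS) -add1n leq_add2r.
Qed.

Lemma block_seq_set0 p : block_seq set0 p = (p == [::]).
Proof.
case/lastP: p => [|p B]; first by rewrite block_seq_nil !eqxx.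
by rewrite block_seq_rcons subset0 andbA andbN -size_eq0 size_rcons.
Qed.

Lemma mem_block_seqs k S p : (#|S| <= k)%N ->
  (p \in block_seqs k S) = block_seq S p.
Proof.
elim: k S p => [|k IHk] S p leSk.
  move: leSk; rewrite leqn0 cards_eq0 => /eqP -> /=.
  by rewrite eqxx inE block_seq_set0.
rewrite /=; have [->|S0] := eqVneq S set0; first by rewrite inE block_seq_set0.
apply/allpairsPdep/idP => [[B [q []]]|].
  rewrite mem_enum inE => /andP[BS B0]; rewrite IHk => [Bq ->|].
    by rewrite block_seq_rcons BS B0.
  exact: card_setD_block leSk.
case/lastP: p => [|q B]; first by rewrite block_seq_nil (negPf S0).
rewrite block_seq_rcons => /and3P[BS B0 Bq]; exists B, q.
by rewrite mem_enum inE BS B0 IHk ?(card_setD_block BS).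
Qed.

Lemma block_seqs_uniq k S : uniq (block_seqs k S).
Proof.
elim: k S => [|k IHk] S /=; case: ifP => // _.
apply: allpairs_uniq_dep => [|B _|]; rewrite ?enum_uniq //.
by move=> [B p] [C q] _ _ /= /rcons_inj[-> ->].
Qed.

End OrderedPartitions.

(** * The recursion for the right-hand side *)

Lemma omega_rcons (K : fieldType) (n : nat) (S : {set 'I_n}) q B :
  block_seq S (rcons q B) -> omega K (rcons q B) = omega K q / #|S|%:R.
Proof.
move=> bS; rewrite /omega size_rcons big_ord_recr /= invfM mulrC.
(* The last factor adds up all block sizes, which gives [#|S|]; the others see only prefixes of
   [q]. *)
rewrite -(size_rcons q B) take_size (block_seq_card bS) mulrC; congr (_^-1 * _).
apply: eq_bigr => i _.
by rewrite -cats1 takel_cat.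
Qed.

Lemma Lblock_word_sum (K : fieldType) (A : lmodType K)
    (mul : {bilinear A -> A -> A}) (R : {linear A -> A}) (theta : K)
    (n : nat) (x : 'I_n -> A) (B : {set 'I_n}) :
  Lblock mul R theta x B = R (word_sum (prelie mul R theta) x B).
Proof.
rewrite /Lblock -linear_sum; congr (R _).
transitivity (\sum_(s : 'S_#|B|) lfold (prelie mul R theta)
   (map x [seq enum_val (s i) | i : 'I_#|B|])).
  by apply: eq_bigr => s _; rewrite -map_comp.
rewrite (sum_perm_words (fun w => lfold (prelie mul R theta) (map x w))).
  apply/perm_big/perm_permutations; rewrite perm_enum_set.
  rewrite map_inj_uniq ?enum_uniq; last exact: enum_val_inj.
  apply/eqP/setP=> j; rewrite inE; apply/codomP/idP => [[i ->]|jB].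
    exact: enum_valP.
  by exists (enum_rank_in jB j); rewrite enum_rankK_in.
exact: enum_val_inj.
Qed.

Lemma nested_block_seqs (K : fieldType) (charK0 : [pchar K] =i pred0)
    (A : lmodType K) (mul : {bilinear A -> A -> A}) (R : {linear A -> A})
    (theta : K) (RB : rota_baxter mul R theta)
    (n : nat) (x : 'I_n -> A) (k : nat) (S : {set 'I_n}) :
  S != set0 -> (#|S| <= k)%N ->
  \sum_(p <- block_seqs k S)
     omega K p *: lfold mul [seq Lblock mul R theta x B | B <- p] =
  R (word_sum (fun a b => mul (R a) b) x S).
Proof.
elim: k S => [|k IHk] S S0 leSk.
  by move: leSk; rewrite leqn0 cards_eq0 (negPf S0).
have natS0 : #|S|%:R != 0 :> K by rewrite ((pcharf0P K).1 charK0) cards_eq0.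
(* Multiplying by [#|S|], nonzero in characteristic zero, will cancel the last factor in [omega];
   the other side becomes a sum over last blocks. *)
apply: (scalerI natS0); rewrite -(dynkin_identity RB) scaler_sumr.
rewrite /= (negPf S0) big_allpairs_dep big_enum /=.
apply: eq_bigr => B /andP[BS B0].
transitivity (\sum_(q <- block_seqs k (S :\: B)) omega K q *:
   lfold mul (rcons [seq Lblock mul R theta x B | B <- q]
                    (Lblock mul R theta x B))).
  apply: eq_big_seq => q; rewrite mem_block_seqs ?(card_setD_block BS) // => Bq.
  rewrite (@omega_rcons K n S) ?block_seq_rcons ?BS ?B0 // map_rcons scalerA.
  by rewrite mulrCA divff ?mulr1.
(* If the last block is all of [S], only the empty sequence precedes it, with weight 1; otherwise
   [q] is nonempty and [lfold] is a genuine product. *)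
rewrite /lact; case: eqVneq => [SB|SB].
  rewrite (_ : block_seqs _ _ = [:: [::]]); last
    by case: (k) => [|m]; rewrite /= SB eqxx.
  by rewrite big_seq1 /omega big_ord0 invr1 scale1r Lblock_word_sum.
rewrite -IHk ?(card_setD_block BS) // linear_sumlz; apply: eq_big_seq => q.
rewrite mem_block_seqs ?(card_setD_block BS) //.
rewrite lfold_rcons -Lblock_word_sum linearZl_LR.
by case: q => //=; rewrite block_seq_nil (negPf SB).
Qed.

(** Both index lists are free of duplicates and have the same members: for positive [n] the empty
    sequence is in neither. *)
Lemma big_ordered_partition (V : nmodType) (n : nat) (f : seq {set 'I_n} -> V) :
  (0 < n)%N ->
  \sum_(p : n.-bseq {set 'I_n} | ordered_partition p) f p =
  \sum_(p <- block_seqs n [set: 'I_n]) f p.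
Proof.
move=> n_gt0.
transitivity (\sum_(p <- [seq val p | p in [pred p : n.-bseq {set 'I_n} |
                                          ordered_partition p]]) f p).
  by rewrite big_image.
apply: perm_big; apply: uniq_perm; first 2 last.
- move=> p; rewrite mem_block_seqs ?cardsT ?card_ord //.
  have -> : block_seq [set: 'I_n] p = ordered_partition p.
    case: p => [|//]; rewrite block_seq_nil /= -cards_eq0 cardsT card_ord.
    by rewrite eqn0Ngt n_gt0.
  apply/imageP/idP => [[q opq ->] //|opp].
  by exists (Bseq (ordered_partition_size opp)).
- by rewrite map_inj_uniq ?enum_uniq //; apply: val_inj.
exact: block_seqs_uniq.
Qed.

Theorem theorem6p2 (K : fieldType) (charK0 : [pchar K] =i pred0)
    (A : lmodType K) (mul : {bilinear A -> A -> A}) (R : {linear A -> A})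
    (theta : K) (RB : rota_baxter mul R theta)
    (n : nat) (n_gt0 : (0 < n)%N) (x : 'I_n -> A) :
  \sum_(s : 'S_n) nestedR mul R [seq x (s i) | i : 'I_n] =
  \sum_(p : n.-bseq {set 'I_n} | ordered_partition p)
     omega K p *: lfold mul [seq Lblock mul R theta x B | B <- p].
Proof.
rewrite (big_ordered_partition
  (fun p => omega K p *: lfold mul [seq Lblock mul R theta x B | B <- p])) //.
rewrite (nested_block_seqs charK0 RB) ?cardsT ?card_ord //.
  rewrite -linear_sum; congr (R _).
  transitivity (\sum_(s : 'S_n) lfold (fun a b => mul (R a) b)
     (map x [seq s i | i : 'I_n])).
    by apply: eq_bigr => s _; rewrite -map_comp.
  rewrite (sum_perm_words (h := id) (fun w => lfold _ (map x w))) //.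
  apply/perm_big/perm_permutations; rewrite perm_enum_set.
  rewrite map_inj_uniq // enum_uniq.
  by apply/eqP/setP=> i; rewrite !inE codom_f.
by rewrite -cards_eq0 cardsT card_ord -lt0n.
Qed.
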